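(* There exists an absolute constant $K>0$ such that the following holds for every real number $C>1$. Suppose that for all integers $k\ge 2$ and all positive integers $n\le C^k$ one has $$c_{n,k}^2\ge c_{n-1,k}\,c_{n+1,k}.$$ Then for every integer $n\ge K\left((\log C)^{-7}+1\right)$ the polynomial $Q_n(z)$ is unimodal.
   Context: For integers $n\ge 0$, the polynomials $Q_n(z)$ are defined by the identity of formal power series in $q$ $$\sum_{n=0}^\infty Q_n(z)q^n=\prod_{m=1}^\infty(1-q^m)^{-z-1}.$$ $Q_n(z)$ has degree $n$ and positive coefficients, and $A_{n,k}$ denotes the coefficient of $z^k$ in $Q_n(z)$. The polynomial $Q_n(z)$ is called unimodal if there is an integer $k_1\in[0,n]$ such that $A_{n,i}\le A_{n,i+1}$ for all $0\le i<k_1$ and $A_{n,i}\ge A_{n,i+1}$ for all $k_1\le i<n$. For a positive integer $n$ let $\sigma_{-1}(n)=\sum_{d\mid n}d^{-1}$, and let $f(q)=\sum_{n\ge1}\sigma_{-1}(n)q^n$. $c_{n,k}$ denotes the coefficient of $q^n$ in $f(q)^k$. $\log$ is the natural logarithm. *)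

(* Defs.v *)
From mathcomp Require Import all_boot all_order all_algebra.

Set Implicit Arguments.
Unset Strict Implicit.
Unset Printing Implicit Defensive.

Import Order.TTheory GRing.Theory Num.Theory.
Local Open Scope ring_scope.

(* A formal power series in q is the sequence of its coefficients. *)
Definition fps (R : Type) := nat -> R.

Definition fps_one (R : pzSemiRingType) : fps R := fun n => (n == 0%N)%:R.

Definition fps_mul (R : pzSemiRingType) (a b : fps R) : fps R :=
  fun n => \sum_(i < n.+1) a i * b (n - i)%N.

Definition fps_exp (R : pzSemiRingType) (a : fps R) (k : nat) : fps R :=
  iter k (fps_mul a) (fps_one R).

Definition fps_prod (R : pzSemiRingType) (F : nat -> fps R) (M : nat) : fps R :=
  \big[@fps_mul R/fps_one R]_(1 <= m < M.+1) F m.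

(* Meaningful when F m = 1 mod q^m for all m >= 1: then the coefficient of q^n
   in the product over 1 <= m <= M does not depend on M >= n
   (see [fps_prod_stable]). *)
Definition fps_iprod (R : pzSemiRingType) (F : nat -> fps R) : fps R :=
  fun n => fps_prod F n n.

(* a (a - 1) ... (a - j + 1) / j! *)
Definition gbinom (a : {poly rat}) (j : nat) : {poly rat} :=
  (j`!%:R : rat)^-1 *: \prod_(i < j) (a - i%:R).

(* (1 - q^m)^a = \sum_j gbinom a j * (- q^m)^j, for m >= 1 *)
Definition pow_one_sub (m : nat) (a : {poly rat}) : fps {poly rat} :=
  fun n => if (m %| n)%N then (-1) ^+ (n %/ m) * gbinom a (n %/ m) else 0.

Definition Q : nat -> {poly rat} :=
  fps_iprod (fun m => pow_one_sub m (- 'X - 1)).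

Definition A (n k : nat) : rat := (Q n)`_k.

Definition unimodalQ (n : nat) : Prop :=
  exists k1 : nat,
    [/\ (k1 <= n)%N,
        forall i : nat, (i < k1)%N -> A n i <= A n i.+1
      & forall i : nat, (k1 <= i < n)%N -> A n i.+1 <= A n i].

Definition sigma_m1 (n : nat) : rat := \sum_(d <- divisors n) d%:R^-1.

(* The case split is needed because [divisors 0 = [:: 1]]. *)
Definition f : fps rat := fun n => if n is 0%N then 0 else sigma_m1 n.

Definition c (n k : nat) : rat := fps_exp f k n.

Lemma fps_mul_one_mod (R : pzSemiRingType) (a b : fps R) (n : nat) :
  (forall i, (i <= n)%N -> b i = fps_one R i) -> fps_mul a b n = a n.
Proof.
move=> hb; rewrite /fps_mul big_ord_recr /= subnn hb // mulr1 big1 ?add0r //.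
move=> i _; rewrite hb ?leq_subr // /fps_one subn_eq0 leqNgt ltn_ord.
exact: mulr0.
Qed.

Lemma fps_mul_ext (R : pzSemiRingType) (a b b' : fps R) (n : nat) :
  (forall i, (i <= n)%N -> b i = b' i) -> fps_mul a b n = fps_mul a b' n.
Proof. by move=> hb; apply: eq_bigr => i _; rewrite hb ?leq_subr. Qed.

Lemma fps_prod_stable (R : pzSemiRingType) (F : nat -> fps R) (n M : nat) :
  (forall m i, (0 < m)%N -> (i < m)%N -> F m i = fps_one R i) ->
  (n <= M)%N -> fps_prod F M n = fps_iprod F n.
Proof.
move=> hF nM; rewrite /fps_iprod /fps_prod /index_iota !subn1 /= -{1}(subnKC nM).
rewrite iotaD.
have tail : forall l i, (i <= n)%N ->
    (\big[@fps_mul R/fps_one R]_(m <- iota (1 + n) l) F m) i = fps_one R i.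
  move=> l; have: forall m, m \in iota (1 + n) l -> (n < m)%N.
    by move=> m; rewrite mem_iota add1n => /andP[].
  elim: (iota _ _) => [|m s IH] hs i hi; first by rewrite big_nil.
  have hm : (n < m)%N by apply: hs; rewrite mem_head.
  rewrite big_cons fps_mul_one_mod => [|j hj].
    by rewrite hF ?(leq_ltn_trans _ hm).
  by apply: IH (leq_trans hj hi) => p ps; apply: hs; rewrite inE ps orbT.
suff gen : forall s k, (k <= n)%N ->
    (\big[@fps_mul R/fps_one R]_(m <- s ++ iota (1 + n) (M - n)) F m) k =
    (\big[@fps_mul R/fps_one R]_(m <- s) F m) k by exact: gen.
elim=> [|m s IH] k hk; first by rewrite cat0s big_nil tail.
rewrite cat_cons !big_cons; apply: fps_mul_ext => i hi.
exact: IH (leq_trans hi hk).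
Qed.

Lemma pow_one_sub_mod (a : {poly rat}) (m i : nat) :
  (0 < m)%N -> (i < m)%N -> pow_one_sub m a i = fps_one {poly rat} i.
Proof.
move=> m0 im; rewrite /pow_one_sub /fps_one; case: i im => [|i] im.
  by rewrite dvdn0 div0n /gbinom big_ord0 expr0 mul1r fact0 invr1 scale1r.
by rewrite gtnNdvd.
Qed.

Lemma Q_stable (n M : nat) : (n <= M)%N ->
  Q n = fps_prod (fun m => pow_one_sub m (- 'X - 1)) M n.
Proof.
move=> nM; rewrite fps_prod_stable // => m i; exact: pow_one_sub_mod.
Qed.

(* Main.v *)
Require Import Defs.
From mathcomp Require Import all_boot all_order all_algebra.
From mathcomp Require Import boolp reals exp ring lra zify.
Import Order.TTheory GRing.Theory Num.Theory.
Set Implicit Arguments.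
Unset Strict Implicit.
Unset Printing Implicit Defensive.
Local Open Scope ring_scope.

(** Write D = q d/dq for the Euler derivation. Since f = - log \prod (1 - q^m),
the generating series of the Q_n is exp ((z + 1) f). Hence Q_n(z) = P_n(z + 1),
where P_n has coefficients c_{n,k} / k! ([Q_expf]), and the coefficients
A_{n,k} of Q_n satisfy two recurrences in n, obtained by differentiating the
exponential with respect to q and to z ([A_theta], [A_rec]):
  n A_{n,k} = \sum_i i f_i (A_{n-i,k} + A_{n-i,k-1}),
  (k + 1) A_{n,k+1} = \sum_i f_i A_{n-i,k}.
Unimodality of A_{n,k} in k is proved separately in two overlapping ranges.

For small k the sequence increases ([A_le_next]). In the first recurrence, the
terms with i <= T contribute at most
T ((k + 1) A_{n,k+1} + k A_{n,k}), by i f_i <= T f_i and the second recurrence.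
The terms with i > T are negligible: A_{n,k} is nondecreasing in n, so the
first recurrence with f_i >= 1 gives n A_{n,k} >= (J^2 / 2) A_{n-J,k}, that is,
A_{n,k} at least doubles each time n moves by J ~ 2 sqrt n ([A_double]). So if
T is J times a large multiple of log n and T is at most n / (4 k + 2), then
n A_{n,k} <= T ((k + 1) A_{n,k+1} + k A_{n,k}) + (n / 2) A_{n,k}, which forces
A_{n,k} <= A_{n,k+1}. This covers all k up to about sqrt n / log n.

For large k the sequence is log-concave ([A_log_concave]). Suppose that
c_{m,k} is log-concave in m for m <= n. Since c_{.,k+1} is the convolution of f
with c_{.,k}, the ratio c_{m,k+1} / c_{m,k} is nondecreasing in m
([c_ratio_le]). Expanding c_{n,k+1} and c_{n,k+2} by the identity
D (f^k) = k f^(k-1) D f then gives that c_{n,k} / k! is log-concave in k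
([c_newton]). The substitution z -> z + 1 preserves log-concavity
([log_concave_poly_shift]), so A_{n,k} is log-concave in k. The hypothesis
on C provides this for k >= k0 ~ log n / log C.

Finally, n >= K (log C)^-7 gives 1 / log C <= n^(1/7), so that k0 is of order at
most n^(1/7) log n, which lies in the range where the sequence increases. *)

(** * Formal power series and the Euler derivation *)

Section FormalSeries.
Variable R : comNzRingType.
Implicit Types a b d : fps R.

(* Ring laws for series are read off from polynomials: the coefficients up to
   [N] of a product depend only on the truncations at [N]. *)
Let trunc (N : nat) a : {poly R} := \poly_(i < N.+1) a i.

Let coef_trunc N a n : (n <= N)%N -> (trunc N a)`_n = a n.
Proof. by move=> nN; rewrite coef_poly ltnS nN. Qed.

Let fps_mul_trunc N a b n :
  (n <= N)%N -> fps_mul a b n = (trunc N a * trunc N b)`_n.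
Proof.
move=> nN; rewrite coefM; apply: eq_bigr => i _.
by rewrite !coef_trunc ?(leq_trans (leq_ord i)) ?(leq_trans (leq_subr i n)).
Qed.

Lemma fps_mulC a b : fps_mul a b = fps_mul b a.
Proof.
by apply: funext => n; rewrite !(@fps_mul_trunc n) // mulrC.
Qed.

Lemma fps_mulA a b d : fps_mul a (fps_mul b d) = fps_mul (fps_mul a b) d.
Proof.
apply: funext => n; have -> : fps_mul a (fps_mul b d) n =
    (trunc n a * (trunc n b * trunc n d))`_n.
  rewrite coefM; apply: eq_bigr => i _.
  by rewrite coef_trunc ?leq_ord // -(@fps_mul_trunc n) ?leq_subr.
rewrite mulrA coefM; apply: eq_bigr => i _.
by rewrite coef_trunc ?leq_subr // -(@fps_mul_trunc n) ?leq_ord.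
Qed.

Lemma fps_mulDl a b d n :
  fps_mul (fun i => a i + b i) d n = fps_mul a d n + fps_mul b d n.
Proof. by rewrite -big_split; apply: eq_bigr => i _; rewrite /= mulrDl. Qed.

Lemma fps_mulMnr a b k n :
  fps_mul a (fun i => b i *+ k) n = fps_mul a b n *+ k.
Proof. by rewrite -sumrMnl; apply: eq_bigr => i _; rewrite mulrnAr. Qed.

(** The Euler derivation q d/dq. *)
Definition fps_theta a : fps R := fun n => a n *+ n.

Lemma fps_thetaM a b n :
  fps_theta (fps_mul a b) n =
  fps_mul (fps_theta a) b n + fps_mul a (fps_theta b) n.
Proof.
rewrite /fps_theta -sumrMnl -big_split; apply: eq_bigr => i _ /=.
by rewrite mulrnAl mulrnAr -mulrnDr subnKC // leq_ord.
Qed.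

Lemma fps_theta_exp a k n :
  fps_theta (fps_exp a k.+1) n =
  fps_mul (fps_theta a) (fps_exp a k) n *+ k.+1.
Proof.
elim: k n => [|k IH] n.
  rewrite fps_thetaM -[RHS]addr0; congr (_ + _); rewrite /fps_mul big1 // => i _.
  by rewrite /fps_theta /fps_one; case: eqP => [->|]; rewrite ?mul0rn mulr0.
rewrite fps_thetaM; have {IH} -> := funext IH.
by rewrite fps_mulMnr (fps_mulA a (fps_theta a)) [fps_mul a (fps_theta a)]fps_mulC -fps_mulA [RHS]mulrS.
Qed.

End FormalSeries.

(** * The logarithmic derivative of the product defining Q *)

(** The logarithmic derivative of (1 - q^m)^a, namely - a m q^m / (1 - q^m). *)
Definition pow_logder (m : nat) (a : {poly rat}) : fps {poly rat} :=
  fun n => if (m %| n)%N && (0 < n)%N then - a *+ m else 0.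

(** The coefficientwise form of D G = - a y / (1 - y) G for G = (1 - y)^a and
D = y d/dy; by induction it reduces to (j + 1) binom(a, j + 1) =
(a - j) binom(a, j). *)
Lemma gbinom_sum (a : {poly rat}) j :
  ((-1) ^+ j * gbinom a j) *+ j =
  - a * \sum_(i < j) (-1) ^+ i * gbinom a i.
Proof.
elim: j => [|j IH]; first by rewrite big_ord0 mulr0 mulr0n.
rewrite big_ord_recr /= mulrDr -IH.
have gS : gbinom a j.+1 *+ j.+1 = gbinom a j * (a - j%:R).
  rewrite /gbinom big_ord_recr /= -scaler_nat scalerA factS natrM invfM mulrA.
  by rewrite divff ?pnatr_eq0 // mul1r scalerAl.
rewrite -mulrnAr gS exprS -[in RHS]mulr_natr; ring.
Qed.

Lemma sum_dvd (V : nmodType) (F : nat -> V) m j : (0 < m)%N ->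
  \sum_(i < (m * j).+1) (if (m %| i)%N then F i else 0) =
  \sum_(i < j.+1) F (m * i)%N.
Proof.
move=> m0; elim: j => [|j IH]; first by rewrite muln0 !big_ord1 dvdn0 muln0.
rewrite [RHS]big_ord_recr /= -IH.
rewrite -!(big_mkord xpredT (fun i => if (m %| i)%N then F i else 0)).
rewrite mulnSr (big_cat_nat (n := (m * j).+1)) ?ltnS ?leq_addr //=.
congr (_ + _); rewrite big_nat_recr /=; last first.
  by rewrite -[(m * j).+1]addn1 leq_add2l.
rewrite -mulnSr dvdn_mulr // big1_seq ?add0r // => i.
rewrite mem_index_iota => /andP[_ /andP[h1 h2]].
case: ifP => // /dvdnP[q qE]; move: h1 h2; rewrite qE [(q * m)%N]mulnC.
by rewrite !ltn_pmul2l // => h1; rewrite ltnS leqNgt h1.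
Qed.

Lemma fps_theta_pow_one_sub m (a : {poly rat}) n : (0 < m)%N ->
  fps_theta (pow_one_sub m a) n =
  fps_mul (pow_logder m a) (pow_one_sub m a) n.
Proof.
move=> m0; rewrite fps_mulC /fps_theta /fps_mul.
have [/dvdnP[j ->]|mn] := boolP (m %| n)%N; last first.
  rewrite /pow_one_sub (negPf mn) mul0rn big1 // => i _.
  case: ifP => mi; last by rewrite mul0r.
  by rewrite /pow_logder dvdn_subl ?leq_ord // (negPf mn) mulr0.
rewrite mulnC; pose F i := (-1) ^+ (i %/ m) * gbinom a (i %/ m) *
                         pow_logder m a (m * j - i)%N.
rewrite (eq_bigr (fun i : 'I_(m * j).+1 => if (m %| i)%N then F i else 0)); last first.
  by move=> i _; rewrite /pow_one_sub; case: ifP => // _; rewrite mul0r.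
rewrite sum_dvd // big_ord_recr /= {2}/F subnn /pow_logder andbF mulr0 addr0.
rewrite /pow_one_sub dvdn_mulr // mulKn // mulnC mulrnA gbinom_sum mulr_sumr -sumrMnl.
apply: eq_bigr => i _; rewrite /F mulKn // -mulnBr /pow_logder dvdn_mulr //.
by rewrite muln_gt0 m0 subn_gt0 ltn_ord /= mulrnAr mulrC.
Qed.

Lemma fps_theta_prod (s : seq nat) (F w : nat -> fps {poly rat}) n :
    (forall m, m \in s -> fps_theta (F m) = fps_mul (w m) (F m)) ->
  fps_theta (\big[@fps_mul _/fps_one _]_(m <- s) F m) n =
  fps_mul (fun i => \sum_(m <- s) w m i)
          (\big[@fps_mul _/fps_one _]_(m <- s) F m) n.
Proof.
elim: s n => [|m s IH] n hs.
  rewrite big_nil /fps_mul big1 => [|i _]; last by rewrite big_nil mul0r.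
  by rewrite /fps_theta /fps_one; case: eqP => [->|]; rewrite ?mul0rn.
rewrite big_cons fps_thetaM hs ?mem_head //.
have hs' p : p \in s -> fps_theta (F p) = fps_mul (w p) (F p).
  by move=> ps; apply: hs; rewrite inE ps orbT.
set B := bigop _ _ _; set W := fun i => \sum_(p <- s) w p i.
have -> : fps_theta B = fps_mul W B by apply: funext => i; exact: IH.
rewrite fps_mulA [fps_mul (F m) W]fps_mulC -!fps_mulA -fps_mulDl.
by congr (fps_mul _ _ n); apply: funext => i; rewrite big_cons.
Qed.

Lemma theta_f n : (0 < n)%N -> fps_theta f n = \sum_(d <- divisors n) d%:R.
Proof.
case: n => // n _; have n0 : (0 < n.+1)%N by [].
rewrite /fps_theta /f -mulr_natl /sigma_m1 mulr_sumr.
have dvdE d : d \in divisors n.+1 -> exists2 e, n.+1 = (e * d)%N & (0 < d)%N.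
  rewrite -dvdn_divisors // => dn; have d0 := dvdn_gt0 n0 dn.
  by case/dvdnP: dn => e dE; exists e.
(* The involution d |-> n / d of the divisors of n. *)
have perm : perm_eq [seq (n.+1 %/ d)%N | d <- divisors n.+1] (divisors n.+1).
  apply: uniq_perm => [||d]; rewrite ?divisors_uniq //.
    rewrite map_inj_in_uniq ?divisors_uniq // => d e /dvdE[d' dE d0] /dvdE[e' eE e0].
    rewrite {1}dE mulnK // eE mulnK // => E; move: eE; rewrite dE E => /eqP.
    by rewrite eqn_pmul2l => [/eqP //|]; move: dE; rewrite E; case: (e').
  apply/mapP/idP => [[e /dvdE[e' eE e0] ->]|/dvdE[e dE d0]].
    by rewrite eE mulnK // -eE -dvdn_divisors // eE dvdn_mulr.
  exists e; last by rewrite dE mulKn //; case: e dE.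
  by rewrite -dvdn_divisors // dE dvdn_mulr.
rewrite -[RHS](perm_big _ perm) big_map; apply: eq_big_seq => d /dvdE[e -> d0].
by rewrite mulnK // natrM mulfK // pnatr_eq0 -lt0n.
Qed.

(** Up to degree [n], the logarithmic derivatives of the factors add up to
(z + 1) D f, because n sigma_{-1}(n) is the sum of the divisors of n. *)
Lemma sum_pow_logder n i : (i <= n)%N ->
  \sum_(m <- index_iota 1 n.+1) pow_logder m (- 'X - 1) i =
  fps_theta f i *: ('X + 1).
Proof.
case: i => [|i] lin.
  by rewrite /fps_theta mulr0n scale0r big1 // => m _; rewrite /pow_logder andbF.
have perm : perm_eq [seq m <- index_iota 1 n.+1 | (m %| i.+1)%N] (divisors i.+1).
  apply: uniq_perm => [||m]; rewrite ?filter_uniq ?iota_uniq ?divisors_uniq //.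
  rewrite mem_filter mem_index_iota -dvdn_divisors //.
  case: (boolP (m %| i.+1)%N) => // mi; rewrite ltnS (dvdn_gt0 _ mi) //=.
  exact: leq_trans (dvdn_leq _ mi) lin.
rewrite theta_f // scaler_suml -[RHS](perm_big _ perm) big_filter [RHS]big_mkcond.
apply: eq_bigr => m _ /=; rewrite /pow_logder andbT scaler_nat.
by rewrite opprD !opprK.
Qed.

Lemma Q_rec n : Q n *+ n = ('X + 1) * \sum_(i < n.+1) fps_theta f i *: Q (n - i).
Proof.
have := @fps_theta_prod (index_iota 1 n.+1) (fun m => pow_one_sub m (- 'X - 1))
  (fun m => pow_logder m (- 'X - 1)) n.
have -> := Q_stable (leqnn n); rewrite /fps_theta => -> => [|m]; last first.
  rewrite mem_index_iota => /andP[m0 _]; apply: funext => i.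
  exact: fps_theta_pow_one_sub.
rewrite /fps_mul mulr_sumr; apply: eq_bigr => i _.
by rewrite sum_pow_logder ?leq_ord // (Q_stable (leq_subr i n)) -scalerAl -scalerAr.
Qed.

(** * The series f and its powers *)

Lemma f_ge1 n : (0 < n)%N -> 1 <= f n.
Proof.
case: n => // n _; rewrite /f /sigma_m1 (bigD1_seq 1%N) ?divisors_uniq //=; last first.
  by rewrite -dvdn_divisors.
by rewrite invr1 lerDl sumr_ge0 // => d _; rewrite invr_ge0 ler0n.
Qed.

Lemma f_ge0 n : 0 <= f n.
Proof. by case: n => // n; exact: le_trans ler01 (f_ge1 _). Qed.

Lemma f_len n : f n <= n%:R.
Proof.
case: n => // n; have le1 d : d%:R^-1 <= 1 :> rat.
  by case: d => [|d]; rewrite ?invr0 // invf_le1 ?ler1n // ltr0n.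
apply: (@le_trans _ _ (\sum_(d <- divisors n.+1) 1)).
  by rewrite /f /sigma_m1; apply: ler_sum => d _; exact: le1.
rewrite big_const_seq count_predT iter_addr_0 ler_nat -[leqRHS](size_iota 1).
apply: uniq_leq_size => [|d]; rewrite ?divisors_uniq // -dvdn_divisors //.
by move=> dn; rewrite mem_iota add1n ltnS (dvdn_gt0 _ dn) // dvdn_leq.
Qed.

Lemma theta_f_ge n : n%:R <= fps_theta f n.
Proof. by case: n => // n; rewrite /fps_theta lerMn2r f_ge1. Qed.

Lemma theta_f_ge0 n : 0 <= fps_theta f n.
Proof. exact: le_trans (ler0n _ n) (theta_f_ge n). Qed.

Lemma c_rec n k : c n k.+1 = \sum_(i < n.+1) f i * c (n - i) k.
Proof. by []. Qed.

Lemma c00 : c 0 0 = 1.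
Proof. by []. Qed.

Lemma c_theta n k :
  c n k.+1 *+ n = (\sum_(i < n.+1) fps_theta f i * c (n - i) k) *+ k.+1.
Proof. exact: fps_theta_exp. Qed.

Lemma c_ge0 n k : 0 <= c n k.
Proof.
elim: k n => [|k IH] n; first by rewrite /c /= /fps_one ler0n.
by rewrite c_rec sumr_ge0 // => i _; rewrite mulr_ge0 ?f_ge0.
Qed.

Lemma c_eq0 n k : (n < k)%N -> c n k = 0.
Proof.
elim: k n => // k IH n; rewrite ltnS => nk; rewrite c_rec big1 // => -[[|i] lin] _ /=.
  by rewrite mul0r.
by rewrite IH ?mulr0 // (leq_trans _ nk) // ltn_subrL (leq_ltn_trans (leq0n i) lin).
Qed.

Lemma c_gt0 n k : (0 < k <= n)%N -> 0 < c n k.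
Proof.
elim: k n => // k IH [|n] // kn; rewrite c_rec.
have [->|k0] := posnP k.
  rewrite (bigD1 ord_max) //= subnn ltr_wpDr //.
    by rewrite sumr_ge0 // => i _; rewrite mulr_ge0 ?f_ge0 ?c_ge0.
  exact: mulr_gt0 (lt_le_trans ltr01 (f_ge1 (ltn0Sn n))) ltr01.
rewrite (bigD1 (lift ord0 ord0)) //= ltr_wpDr //.
  by rewrite sumr_ge0 // => i _; rewrite mulr_ge0 ?f_ge0 ?c_ge0.
have h : 0 < c (n.+1 - 1) k by rewrite subn1 IH // k0.
exact: mulr_gt0 (lt_le_trans ltr01 (f_ge1 (ltn0Sn 0))) h.
Qed.

(** * Q as a shifted exponential, and the recurrences for its coefficients *)

(** The coefficient of q^n in exp (z f). *)
Definition expf n : {poly rat} := \poly_(k < n.+1) (c n k / k`!%:R).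

Lemma coef_expf n k : (expf n)`_k = c n k / k`!%:R.
Proof. by rewrite coef_poly ltnS; case: leqP => // nk; rewrite c_eq0 ?mul0r. Qed.

Lemma expf_rec n :
  expf n *+ n = 'X * \sum_(i < n.+1) fps_theta f i *: expf (n - i).
Proof.
apply/polyP => -[|k]; rewrite coefMn coefXM coef_expf.
  by rewrite /c /= /fps_one; case: n => [|n]; rewrite ?mulr0n // mul0r mul0rn.
rewrite -mulrnAl c_theta coef_sum /= -mulr_natr -mulrA.
rewrite factS natrM invfM (mulrA _ k.+1%:R^-1) divff ?pnatr_eq0 // mul1r mulr_suml.
by apply: eq_bigr => i _; rewrite coefZ coef_expf mulrA.
Qed.

Lemma deriv_expf n : (expf n)^`() = \sum_(i < n.+1) f i *: expf (n - i).
Proof.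
apply/polyP => k; rewrite coef_deriv coef_expf -[LHS]mulr_natr -mulrA.
rewrite factS natrM invfM mulrAC mulVf ?pnatr_eq0 // mul1r c_rec mulr_suml coef_sum.
by apply: eq_bigr => i _; rewrite coefZ coef_expf mulrA.
Qed.

(** Both sides satisfy n U_n = (z + 1) \sum_i i f_i U_{n-i} and U_0 = 1, which
determines U. *)
Lemma Q_expf n : Q n = expf n \Po ('X + 1).
Proof.
elim/ltn_ind: n => -[_|n IH].
  rewrite /expf poly_def big_ord1 expr0 /Q /fps_iprod /fps_prod big_geq //.
  by rewrite fact0 divr1 c00 scale1r -polyC1 comp_polyC.
apply: (@scalerI _ {poly rat} n.+1%:R); first by rewrite pnatr_eq0.
rewrite !scaler_nat Q_rec -(raddfMn (comp_poly ('X + 1))) /= expf_rec rmorphM /= comp_polyX.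
congr (_ * _); rewrite rmorph_sum /= big_ord_recl [in RHS]big_ord_recl /=.
rewrite /fps_theta mulr0n !scale0r linear0; congr (_ + _).
apply: eq_bigr => i _; rewrite linearZ /= IH //.
by rewrite /bump /= add1n subSS ltnS leq_subr.
Qed.

Lemma deriv_Q n : (Q n)^`() = \sum_(i < n.+1) f i *: Q (n - i).
Proof.
rewrite Q_expf deriv_comp derivD derivX derivC addr0 mulr1 deriv_expf linear_sum /=.
by apply: eq_bigr => i _; rewrite linearZ Q_expf.
Qed.

Lemma A_theta0 n : A n 0 *+ n = \sum_(i < n.+1) fps_theta f i * A (n - i) 0.
Proof.
rewrite /A -coefMn Q_rec mulrDl mul1r coefD coefXM add0r coef_sum.
by apply: eq_bigr => i _; rewrite coefZ.
Qed.

Lemma A_theta n k : A n k.+1 *+ n =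
  \sum_(i < n.+1) fps_theta f i * (A (n - i) k.+1 + A (n - i) k).
Proof.
rewrite /A -coefMn Q_rec mulrDl mul1r coefD coefXM addrC !coef_sum -big_split /=.
by apply: eq_bigr => i _; rewrite !coefZ mulrDr.
Qed.

Lemma A_rec n k : A n k.+1 *+ k.+1 = \sum_(i < n.+1) f i * A (n - i) k.
Proof.
rewrite /A -coef_deriv deriv_Q coef_sum.
by apply: eq_bigr => i _; rewrite coefZ.
Qed.

Lemma A00 : A 0 0 = 1.
Proof. by rewrite /A /Q /fps_iprod /fps_prod big_geq // /fps_one coefMn coef1. Qed.

(** The numbers A_{n,0} are the partition numbers, with generating series
P = \prod (1 - q^m)^-1. The differences d_n are the coefficients of (1 - q) P,
whose logarithmic derivative is D f - q / (1 - q); it has nonnegative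
coefficients i f_i - 1, so that the d_n are nonnegative by induction. *)
Lemma A_le_succ0 n : A n 0 <= A n.+1 0.
Proof.
pose d i := A i.+1 0 - A i 0; rewrite -subr_ge0 -/(d n).
elim/ltn_ind: n => n IH.
have pE : A n 0 = \sum_(i < n) d (n - i.+1)%N + A 0 0.
  apply/eqP; rewrite -subr_eq; apply/eqP.
  have := @telescope_sumr _ 0 n (fun i => - A (n - i) 0) (leq0n n).
  rewrite subn0 subnn opprK addrC => <-; rewrite big_mkord; apply: eq_bigr => i _.
  by rewrite /d subnSK // opprK addrC.
have dE : d n *+ n.+1 + A n 0 =
    \sum_(i < n) fps_theta f i.+1 * d (n - i.+1)%N + fps_theta f n.+1 * A 0 0.
  have -> : d n *+ n.+1 + A n 0 = A n.+1 0 *+ n.+1 - A n 0 *+ n.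
    by rewrite /d mulrnBl [A n 0 *+ n.+1]mulrSr; ring.
  rewrite !A_theta0 big_ord_recr /= subnn addrAC; congr (_ + _).
  rewrite -sumrB big_ord_recl /= /fps_theta mulr0n !mul0r subrr add0r.
  apply: eq_bigr => i _; rewrite /bump /= add1n -mulrBr /d subSS.
  by rewrite -subSn.
suff : 0 <= d n *+ n.+1 by rewrite pmulrn_lge0.
have -> : d n *+ n.+1 = d n *+ n.+1 + A n 0 - A n 0 by rewrite addrK.
rewrite dE pE subr_ge0 A00 lerD //; last first.
  by rewrite mulr1 (le_trans _ (theta_f_ge _)) // ler1n.
apply: ler_sum => i _; rewrite ler_peMl //.
  by apply: IH; rewrite ltn_subrL /= (leq_ltn_trans _ (ltn_ord i)).
by rewrite (le_trans _ (theta_f_ge _)) // ler1n.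
Qed.

Lemma A_ge0 n k : 0 <= A n k.
Proof.
elim: k n => [|k IH] n.
  elim: n => [|n IH]; first by rewrite A00.
  exact: le_trans (A_le_succ0 n).
rewrite -(pmulrn_lge0 _ (ltn0Sn k)) A_rec sumr_ge0 // => i _.
by rewrite mulr_ge0 ?f_ge0.
Qed.

(** Monotonicity passes from [k] to [k.+1] since A_{.,k+1} is, up to a factor,
the convolution of A_{.,k} with a nonnegative sequence. *)
Lemma A_le_succ n k : A n k <= A n.+1 k.
Proof.
elim: k n => [|k IH] n; first exact: A_le_succ0.
rewrite -(ler_pMn2r (ltn0Sn k)) !A_rec [leRHS]big_ord_recr /=.
apply: ler_wpDr; first exact: mulr_ge0 (f_ge0 n.+1) (A_ge0 _ k).
apply: ler_sum => i _.
by rewrite ler_wpM2l ?f_ge0 // subSn ?IH // leq_ord.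
Qed.

Lemma A_le m n k : (m <= n)%N -> A m k <= A n k.
Proof.
move=> mn; rewrite -(subnKC mn); elim: (n - m)%N => [|d IH]; first by rewrite addn0.
by rewrite addnS (le_trans IH) // A_le_succ.
Qed.

Lemma A_gt0 n k : (k <= n)%N -> 0 < A n k.
Proof.
elim: k n => [|k IH] n kn.
  by rewrite (lt_le_trans ltr01) // -A00 A_le.
rewrite -(pmulrn_lgt0 _ (ltn0Sn k)) A_rec; case: n kn => // n kn.
rewrite (bigD1 (lift ord0 ord0)) //= ltr_wpDr //.
  by rewrite sumr_ge0 // => i _; rewrite mulr_ge0 ?f_ge0 ?A_ge0.
have h : 0 < A (n.+1 - 1) k by rewrite subn1 IH.
exact: mulr_gt0 (lt_le_trans ltr01 (f_ge1 (ltn0Sn 0))) h.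
Qed.

(** * The coefficients increase for small k *)

(** The value A_{n,k-1}, read as 0 for k = 0, which lets the recurrences be
stated uniformly in k. *)
Definition Apred n k : rat := if k is k'.+1 then A n k' else 0.

Lemma Apred_ge0 n k : 0 <= Apred n k.
Proof. by case: k => // k; exact: A_ge0. Qed.

Lemma Apred_le m n k : (m <= n)%N -> Apred m k <= Apred n k.
Proof. by case: k => // k; exact: A_le. Qed.

Lemma A_theta_pred n k : A n k *+ n =
  \sum_(i < n.+1) fps_theta f i * (A (n - i) k + Apred (n - i) k).
Proof.
case: k => [|k]; last exact: A_theta.
by rewrite A_theta0; apply: eq_bigr => i _; rewrite addr0.
Qed.

Lemma Apred_rec n k : A n k *+ k = \sum_(i < n.+1) f i * Apred (n - i) k.
Proof.
case: k => [|k]; last exact: A_rec.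
by rewrite mulr0n big1 // => i _; rewrite mulr0.
Qed.

Lemma Apred_le_A n k : Apred n k <= A n.+1 k *+ k.
Proof.
have h : Apred n k <= f 1 * Apred (n.+1 - 1) k.
  by rewrite subn1 ler_peMl ?Apred_ge0 // f_ge1.
rewrite Apred_rec (bigD1 (lift ord0 ord0)) //; apply: ler_wpDr; last exact: h.
by apply: sumr_ge0 => i _; rewrite mulr_ge0 ?f_ge0 ?Apred_ge0.
Qed.

(** Keep only the terms i <= J of the recurrence for n A_{n,k}: each is at least
i A_{n-J,k}, and the sum of these i is at least 2 n. *)
Lemma A_double n J k : (0 < n)%N -> (J <= n)%N -> (4 * n <= J ^ 2)%N ->
  A (n - J) k *+ 2 <= A n k.
Proof.
move=> n0 Jn hJ; rewrite -(ler_pMn2r n0) A_theta_pred.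
have sumJ : ((\sum_(i < J.+1) i) * 2 = J * J.+1)%N.
  by elim: (J) => [|m IH]; rewrite ?big_ord1 // big_ord_recr /= mulnDl IH; lia.
apply: (@le_trans _ _ (\sum_(i < J.+1) A (n - J) k *+ i)).
  rewrite sumrMnr -mulrnA ler_wpMn2l ?A_ge0 //.
  by rewrite -(leq_pmul2r (ltn0Sn 1)) sumJ; nia.
rewrite -(subnKC Jn) -addSn big_split_ord /=; apply: ler_wpDr.
  by apply: sumr_ge0 => i _; rewrite mulr_ge0 ?theta_f_ge0 // addr_ge0 ?A_ge0 ?Apred_ge0.
apply: ler_sum => i _; rewrite subnKC // -mulr_natl ler_pM ?ler0n ?A_ge0 ?theta_f_ge //.
by apply: ler_wpDr; rewrite ?Apred_ge0 // A_le // leq_sub2l // leq_ord.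
Qed.

Lemma A_decay n s J k : (0 < n)%N -> (s * J <= n)%N -> (4 * n <= J ^ 2)%N ->
  A (n - s * J) k *+ 2 ^ s <= A n k.
Proof.
move=> n0 + hJ; elim: s => [|s IH] sJ; first by rewrite mul0n subn0.
have sJ' : (s * J <= n)%N by lia.
apply: le_trans (IH sJ'); rewrite expnS mulrnA ler_wMn2r //.
rewrite mulSn addnC subnDA; apply: A_double; nia.
Qed.

(** With T = s J, the terms i <= T of the recurrence for n A_{n,k} are controlled
by A_{n,k+1} and A_{n,k}, while those with i > T are at most
n^2 (k + 1) A_{n-T,k}, which the factor 2^s of [A_decay] makes negligible. *)
Lemma A_le_next n s J k :
    (0 < n)%N -> (4 * n <= J ^ 2)%N -> (2 * n ^ 2 * n.+1 <= 2 ^ s)%N ->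
    ((4 * k + 2) * (s * J) <= n)%N ->
  A n k <= A n k.+1.
Proof.
move=> n0 hJ hs hT; have J0 : (0 < J)%N by nia.
have s0 : (0 < s)%N by case: s hs {hT} => // ; nia.
set T := (s * J)%N in hT; have T0 : (0 < T)%N by rewrite muln_gt0 s0.
have kn : (k < n)%N by nia.
have Tn : (T < n)%N by nia.
have decay : A (n - T) k * (2 ^ s)%:R <= A n k.
  by rewrite mulr_natr; apply: A_decay => //; exact: ltnW.
set W := A (n - T) k in decay; have W0 : 0 <= W := A_ge0 _ _.
(* For each i one of the two bounds applies, and the other is nonnegative, so
   their sum bounds every term. *)
have term (i : 'I_n.+1) :
    fps_theta f i * (A (n - i) k + Apred (n - i) k) <=
    T%:R * (f i * A (n - i) k) + T%:R * (f i * Apred (n - i) k)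
    + n%:R ^+ 2 * (W *+ k.+1).
  have D0 : 0 <= A (n - i) k + Apred (n - i) k by rewrite addr_ge0 ?A_ge0 ?Apred_ge0.
  rewrite -mulrDr -mulrDr /fps_theta -[f i *+ i]mulr_natl.
  have [iT|Ti] := leqP i T.
    apply: ler_wpDr; first by rewrite mulr_ge0 ?exprn_ge0 ?mulrn_wge0.
    by rewrite -mulrA ler_wpM2r ?ler_nat // mulr_ge0 ?f_ge0.
  apply: ler_wpDl; first by rewrite !mulr_ge0 ?f_ge0.
  apply: ler_pM => //; first by rewrite mulr_ge0 ?f_ge0.
    by rewrite expr2 ler_pM ?f_ge0 // ?(le_trans (f_len _)) ?ler_nat // leq_ord.
  rewrite mulrS lerD //; first by rewrite A_le // leq_sub2l // ltnW.
  apply: le_trans (Apred_le (n := (n - T).-1) k _) _; first lia.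
  by rewrite (le_trans (Apred_le_A _ _)) // prednK // subn_gt0.
have main : A n k * n%:R <= T%:R * (A n k.+1 * k.+1%:R) + T%:R * (A n k * k%:R)
    + n%:R ^+ 2 * (W * k.+1%:R) * n.+1%:R.
  rewrite [A n k * n%:R]mulr_natr A_theta_pred [A n k * k%:R]mulr_natr Apred_rec.
  rewrite [A n k.+1 * _]mulr_natr A_rec [W * _]mulr_natr.
  have -> : n%:R ^+ 2 * (W *+ k.+1) * n.+1%:R =
      \sum_(i < n.+1) (n%:R ^+ 2 * (W *+ k.+1)) by rewrite sumr_const card_ord mulr_natr.
  rewrite !mulr_sumr -!big_split /=.
  by apply: ler_sum => i _; exact: term.
have tail : n%:R ^+ 2 * (W * k.+1%:R) * n.+1%:R * 2 <= A n k * n%:R.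
  have h : ((2 * n ^ 2 * n.+1)%N%:R : rat) <= (2 ^ s)%:R by rewrite ler_nat.
  have hk : (k.+1%:R : rat) <= n%:R by rewrite ler_nat.
  apply: le_trans (ler_wpM2r (ler0n _ n) decay).
  apply: le_trans (ler_wpM2r (ler0n _ n) (ler_wpM2l W0 h)).
  rewrite !natrM.
  rewrite [leLHS](_ : _ = W * n%:R ^+ 2 * 2 * n.+1%:R * k.+1%:R); last by ring.
  rewrite [leRHS](_ : _ = W * n%:R ^+ 2 * 2 * n.+1%:R * n%:R); last by ring.
  by rewrite ler_wpM2l // !mulr_ge0 ?exprn_ge0.
have hn : (((4 * k + 2) * T)%N%:R : rat) <= n%:R by rewrite ler_nat.
have {}hn := ler_wpM2l (A_ge0 n k) hn.
have TK : 0 < T%:R * k.+1%:R :> rat by rewrite mulr_gt0 ?ltr0n.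
rewrite -(ler_pM2l TK); move: main tail hn; rewrite natrM natrD natrM -natr1.
set tl := _ * n.+1%:R; lra.
Qed.

(** * Log-concavity of the powers of f *)

(** Log-concavity without internal zeros says that the ratios u_{i+1} / u_i are
nonincreasing on [a, b]; hence so are u_{i+d} / u_i. Here this is stated without
division so that the zeros below [a] are included. *)
Lemma log_concave_shift (R : realDomainType) (u : nat -> R) a b :
    (forall i, (i < a)%N -> u i = 0) ->
    (forall i, (a <= i <= b)%N -> 0 < u i) ->
    (forall i, (a <= i)%N -> (i.+2 <= b)%N -> u i * u i.+2 <= u i.+1 ^+ 2) ->
  forall i j d, (i <= j)%N -> (j + d <= b)%N ->
  u i * u (j + d)%N <= u (i + d)%N * u j.
Proof.
move=> u0 upos ulc.
have step i e : (a <= i)%N -> (i + e < b)%N ->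
    u i * u (i + e).+1 <= u i.+1 * u (i + e)%N.
  move=> ai; elim: e => [|e IH] ib; first by rewrite addn0 mulrC.
  have e0 : 0 < u (i + e)%N by apply: upos; lia.
  have ui : 0 < u i by apply: upos; lia.
  have ue1 : 0 < u (i + e).+1 by apply: upos; lia.
  have {IH}h1 := ler_wpM2r (ltW ue1) (IH ltac:(lia)).
  have h2 := ler_wpM2l (ltW ui) (ulc (i + e)%N ltac:(lia) ltac:(lia)).
  rewrite -(ler_pM2l e0) !addnS; lra.
move=> i j d ij jb; have [ia|ai] := ltnP i a.
  rewrite u0 // mul0r mulr_ge0 //.
    by case: (ltnP (i + d)%N a) => h; [rewrite u0|rewrite ltW ?upos //; lia].
  by case: (ltnP j a) => h; [rewrite u0|rewrite ltW ?upos //; lia].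
elim: d jb => [|d IH] jb; first by rewrite !addn0.
have {IH}h1 := IH ltac:(lia).
have := @step (i + d)%N (j - i)%N ltac:(lia) ltac:(lia).
rewrite (_ : (i + d + (j - i)) = j + d)%N; last by lia.
move=> h2; rewrite !addnS.
have p1 : 0 < u (i + d)%N by apply: upos; lia.
have p2 : 0 < u (j + d)%N by apply: upos; lia.
have p3 : 0 < u i by apply: upos; lia.
have p4 : 0 < u (i + d).+1 by apply: upos; lia.
rewrite -(ler_pM2l (mulr_gt0 p1 p2)).
have {}h1 := ler_wpM2l (ltW (mulr_gt0 p4 p2)) h1.
have {}h2 := ler_wpM2l (ltW (mulr_gt0 p3 p2)) h2.
lra.
Qed.

Definition c_log_concave n k :=
  forall i, (0 < i <= n)%N -> c i.-1 k * c i.+1 k <= c i k ^+ 2.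

(** In c_{p,k+1} / c_{p,k} = \sum_l f_l c_{p-l,k} / c_{p,k}, every quotient on
the right grows with p by log-concavity. *)
Lemma c_ratio_le p n k : (0 < k)%N -> c_log_concave n k -> (p <= n)%N ->
  c p k.+1 * c n k <= c n k.+1 * c p k.
Proof.
move=> k0 lc pn.
have shift := @log_concave_shift _ (c^~ k) k n (fun i => @c_eq0 i k).
have {}shift : forall i j d, (i <= j)%N -> (j + d <= n)%N ->
    c i k * c (j + d) k <= c (i + d) k * c j k.
  apply: shift => i; first by move=> /andP[ki _]; rewrite c_gt0 // k0.
  by move=> _ i2; apply: (lc i.+1); lia.
rewrite !c_rec !mulr_suml.
rewrite -[in leRHS](subnKC pn) -addSn big_split_ord; apply: ler_wpDr.
  by apply: sumr_ge0 => i _; rewrite !mulr_ge0 ?f_ge0 ?c_ge0.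
apply: ler_sum => i _ /=; rewrite -!mulrA ler_wpM2l ?f_ge0 // subnKC //.
have ip := leq_ord i; have iN := leq_trans ip pn.
have := shift (p - i)%N (n - i)%N i ltac:(lia) ltac:(lia).
by rewrite !subnK // [leRHS]mulrC.
Qed.

(** Multiplied by n, both sides expand by [c_theta] into sums over i of
i f_i c_{n-i,k+1} c_{n,k} and i f_i c_{n-i,k} c_{n,k+1}, which are compared
term by term. *)
Lemma c_newton n k : (0 < k)%N -> (0 < n)%N -> c_log_concave n k ->
  k.+1%:R * (c n k * c n k.+2) <= k.+2%:R * c n k.+1 ^+ 2.
Proof.
move=> k0 n0 lc; have n0' : 0 < n%:R :> rat by rewrite ltr0n.
have e1 := c_theta n k.+1; have e2 := c_theta n k.
rewrite -[LHS]mulr_natr -[RHS]mulr_natr in e1.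
rewrite -[LHS]mulr_natr -[RHS]mulr_natr in e2.
rewrite -(ler_pM2r n0').
rewrite [leLHS](_ : _ = k.+1%:R * c n k * (c n k.+2 * n%:R)); last by ring.
rewrite [leRHS](_ : _ = k.+2%:R * c n k.+1 * (c n k.+1 * n%:R)); last by ring.
rewrite e1 e2.
rewrite [leLHS](_ : _ = k.+1%:R * k.+2%:R *
  (c n k * \sum_(i < n.+1) fps_theta f i * c (n - i) k.+1)); last by ring.
rewrite [leRHS](_ : _ = k.+1%:R * k.+2%:R *
  (c n k.+1 * \sum_(i < n.+1) fps_theta f i * c (n - i) k)); last by ring.
rewrite ler_wpM2l ?mulr_ge0 // !mulr_sumr; apply: ler_sum => i _.
rewrite ![c n _ * _]mulrCA ler_wpM2l ?theta_f_ge0 // mulrC.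
exact: c_ratio_le (leq_subr _ _).
Qed.

(** * Log-concavity is preserved by the substitution z -> z + 1 *)

(** This form excludes internal zeros and needs no division. *)
Definition log_concave_poly (R : realDomainType) (p : {poly R}) :=
  forall i j, (i <= j)%N -> p`_i * p`_j.+1 <= p`_i.+1 * p`_j.

Section Shift.
Variable R : realDomainType.
Implicit Types p : {poly R}.

(* Inductions are along Horner's scheme p X + b, whose shift is
   sh p X + sh p + b. *)
Let sh p := p \Po ('X + 1).

Let sh_cons p b : sh (p * 'X + b%:P) = sh p * 'X + sh p + b%:P.
Proof. by rewrite /sh comp_polyD comp_polyM comp_polyX comp_polyC mulrDr mulr1. Qed.

Let sh0 p b : (sh (p * 'X + b%:P))`_0 = (sh p)`_0 + b.
Proof. by rewrite sh_cons !coefD coefMX coefC add0r. Qed.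

Let shS p b i : (sh (p * 'X + b%:P))`_i.+1 = (sh p)`_i + (sh p)`_i.+1.
Proof. by rewrite sh_cons !coefD coefMX coefC addr0. Qed.

Let coef_cons0 p b : (p * 'X + b%:P)`_0 = b.
Proof. by rewrite coefD coefMX coefC add0r. Qed.

Let coef_consS p b i : (p * 'X + b%:P)`_i.+1 = p`_i.
Proof. by rewrite coefD coefMX coefC addr0. Qed.

Lemma shift_coef_ge0 p : (forall i, 0 <= p`_i) -> forall i, 0 <= (p \Po ('X + 1))`_i.
Proof.
elim/poly_ind: p => [|p b IH] hp i; first by rewrite comp_poly0 coef0.
have b0 : 0 <= b by have := hp 0%N; rewrite coef_cons0.
have {}IH := IH (fun i => _ : 0 <= p`_i); have {}IH j : 0 <= (sh p)`_j.
  by apply: IH => l; have := hp l.+1; rewrite coef_consS.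
by case: i => [|i]; rewrite -/(sh _) ?sh0 ?shS addr_ge0.
Qed.

(** Adding the constant [b] to p X affects only the lowest coefficient of the
shifted polynomial; this is the extra inequality that it has to satisfy for
log-concavity to survive. *)
Let head_bound p b : (forall i, 0 <= (p * 'X + b%:P)`_i) ->
  log_concave_poly (p * 'X + b%:P) ->
  forall j, b * (sh p)`_j.+1 <= (sh p)`_0 * (sh p)`_j.
Proof.
elim/poly_ind: p b => [|p b1 IH] b hp lc j.
  by rewrite /sh comp_poly0 !coef0 !mulr0.
have hp' i : 0 <= (p * 'X + b1%:P)`_i by have := hp i.+1; rewrite coef_consS.
have b10 : 0 <= b1 by have := hp' 0%N; rewrite coef_cons0.
have b0 : 0 <= b by have := hp 0%N; rewrite coef_cons0.
have q0 i : 0 <= (sh p)`_i.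
  by apply: shift_coef_ge0 => l; have := hp' l.+1; rewrite coef_consS.
have {}IH : forall j, b1 * (sh p)`_j.+1 <= (sh p)`_0 * (sh p)`_j.
  apply: IH => // i i' ii'; have := lc i.+1 i'.+1 ii'.
  by rewrite !(coef_consS _ b).
(* Termwise b p_l <= b1 (p X + b1)_l, and shifting is monotone. *)
have cmp i : b * (sh p)`_i <= b1 * (sh (p * 'X + b1%:P))`_i.
  rewrite -subr_ge0 -!coefZ -coefB -!comp_polyZ -comp_polyB.
  apply: shift_coef_ge0 => l; rewrite coefB !coefZ subr_ge0.
  by have := lc 0%N l.+1 (leq0n _); rewrite coef_cons0 !coef_consS coef_cons0.
have next : b * (sh p)`_j.+1 <= (sh p)`_0 * (sh (p * 'X + b1%:P))`_j.
  apply: le_trans (cmp _) _; rewrite shS.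
  case: j => [|j]; rewrite ?sh0 ?shS; have := IH 0%N.
    by move=> h; nra.
  by move=> _; have := IH j; have := IH j.+1; lra.
rewrite shS sh0 mulrDr mulrDl; have := cmp j; lra.
Qed.

(** Multiplication by X + 1 preserves log-concavity; the inequalities that
involve the added constant [b] follow from [head_bound]. *)
Lemma log_concave_poly_shift p :
    (forall i, 0 <= p`_i) -> log_concave_poly p ->
  log_concave_poly (p \Po ('X + 1)).
Proof.
elim/poly_ind: p => [|p b IH] hp lc; first by move=> i j _; rewrite comp_poly0 !coef0.
have hb := head_bound hp lc.
have {}IH : log_concave_poly (sh p).
  apply: IH => [i|i j ij]; first by have := hp i.+1; rewrite coef_consS.
  by have := lc i.+1 j.+1 ij; rewrite !coef_consS.
rewrite -/(sh _) => -[|i] [|j] // ij; rewrite ?sh0 !shS.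
- by rewrite mulrC.
- have h1 := hb j; have h2 := hb j.+1; have h3 := IH 0%N j.+1 (leq0n _).
  have h4 : (sh p)`_0 * (sh p)`_j.+1 <= (sh p)`_1 * (sh p)`_j by exact: IH.
  lra.
have h1 := IH i j ij; have h2 := IH i.+1 j.+1 ij.
have h3 : (sh p)`_i * (sh p)`_j.+2 <= (sh p)`_i.+2 * (sh p)`_j.
  move: ij; rewrite ltnS leq_eqVlt => /orP[/eqP ->|ij]; first by rewrite mulrC.
  by apply: le_trans (IH i.+1 j ij); apply: IH; lia.
lra.
Qed.

End Shift.

(** * The coefficients are log-concave for large k *)

Lemma c_fact_log_concave n k : (0 < k)%N -> (0 < n)%N -> c_log_concave n k ->
  c n k / k`!%:R * (c n k.+2 / (k.+2)`!%:R) <= (c n k.+1 / (k.+1)`!%:R) ^+ 2.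
Proof.
move=> k0 n0 lc; have := c_newton k0 n0 lc.
have F0 : 0 < k`!%:R :> rat by rewrite ltr0n fact_gt0.
have k1 : 0 < k.+1%:R :> rat by rewrite ltr0n.
have k2 : 0 < k.+2%:R :> rat by rewrite ltr0n.
rewrite !factS !natrM; set F := k`!%:R in F0 *; set a := k.+1%:R in k1 *.
set b := k.+2%:R in k2 *; clearbody F a b; set w := (F ^+ 2 * a ^+ 2 * b)^-1.
have w0 : 0 <= w by rewrite invr_ge0 !mulr_ge0 ?exprn_ge0 // ltW.
have [F0' [a0 b0]] : F != 0 /\ a != 0 /\ b != 0 by rewrite !gt_eqF.
move=> /(ler_wpM2r w0); rewrite /w.
rewrite [X in X <= _ -> _](_ : _ = c n k / F * (c n k.+2 / (b * (a * F)))); last first.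
  by field; rewrite F0' a0 b0.
rewrite [X in _ <= X -> _](_ : _ = (c n k.+1 / (a * F)) ^+ 2) //.
by field; rewrite F0' a0 b0.
Qed.

(** For k >= k0 the coefficient A_{n,k} depends only on the c_{n,j} with j >= k0,
since shifting a polynomial of degree less than k0 does not raise its degree.
So the coefficients of P_n below k0, where log-concavity is not known, may be
replaced by 0. *)
Lemma A_log_concave n k0 : (0 < k0)%N -> (0 < n)%N ->
    (forall k, (k0 <= k)%N -> c_log_concave n k) ->
  forall k, (k0 <= k)%N -> A n k * A n k.+2 <= A n k.+1 ^+ 2.
Proof.
move=> k00 n0 lc.
pose u k : rat := if (k0 <= k <= n)%N then c n k / k`!%:R else 0.
pose p : {poly rat} := \poly_(k < n.+1) u k.
have coef_p k : p`_k = u k.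
  by rewrite coef_poly ltnS /u; case: (leqP k n) => //; rewrite andbF.
have u_ge0 k : 0 <= u k.
  by rewrite /u; case: ifP => // _; rewrite divr_ge0 ?c_ge0.
have A_p k : (k0 <= k)%N -> A n k = (p \Po ('X + 1))`_k.
  move=> kk; apply/eqP; rewrite -subr_eq0 /A Q_expf -coefB -comp_polyB.
  apply/eqP/nth_default; rewrite size_comp_poly2; last by rewrite -polyC1 size_XaddC.
  apply: leq_trans kk; apply/leq_sizeP => j kj.
  rewrite coefB coef_expf coef_p /u kj /=.
  by case: leqP => [|/c_eq0 ->]; rewrite ?subrr // mul0r subr0.
have p_lc : log_concave_poly p.
  move=> i j ij; rewrite !coef_p.
  case: (leqP j.+1 n) => jn; last first.
    by rewrite [u j.+1]/u (leqNgt _ n) jn andbF mulr0 mulr_ge0.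
  rewrite -[j.+1]addn1 -[i.+1]addn1;
  apply: (@log_concave_shift _ u k0 n) => //; last by rewrite addn1.
  - by move=> l lk; rewrite /u leqNgt lk.
  - move=> l ln; rewrite /u ln divr_gt0 ?ltr0n ?fact_gt0 // c_gt0 //; lia.
  move=> l kl ln; rewrite /u !ifT; try lia.
  by apply: c_fact_log_concave => //; [lia|exact: lc].
move=> k kk; rewrite !A_p //; try lia.
apply: log_concave_poly_shift => // i; by rewrite coef_p.
Qed.

(** * Unimodality *)

Lemma unimodal_of_log_concave n k0 : (k0 <= n)%N ->
    (forall k, (k < k0)%N -> A n k <= A n k.+1) ->
    (forall k, (k0 <= k)%N -> A n k * A n k.+2 <= A n k.+1 ^+ 2) ->
  unimodalQ n.
Proof.
move=> k0n incr lc.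
(* The mode is the first descent at or after k0, or n if there is none. *)
pose P i := (k0 <= i)%N && ((A n i.+1 <= A n i) || (i == n)).
have exP : exists i, P i by exists n; rewrite /P k0n eqxx orbT.
have [k1 /andP[k01 top] min1] := ex_minnP exP.
exists k1; split; first by apply: min1; rewrite /P k0n eqxx orbT.
  move=> i ik; have [/incr //|ki] := ltnP i k0; rewrite ltW // ltNge.
  apply/negP => le_i; have := min1 i; rewrite /P ki le_i /= leqNgt ik => /(_ isT).
  by [].
move=> i /andP[+ iln]; elim: i iln => [|i IH] iln ki.
  by move: ki top; rewrite leqn0 => /eqP->; rewrite (ltn_eqF iln) orbF.
move: ki; rewrite leq_eqVlt => /orP[/eqP E|ki].
  by move: top; rewrite E (ltn_eqF iln) orbF.
have le_i := IH (ltnW iln) ki.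
have Ai : 0 < A n i by apply: A_gt0; lia.
rewrite -(ler_pM2l Ai); apply: le_trans (lc i (leq_trans k01 ki)) _.
by rewrite expr2 ler_wpM2r ?A_ge0.
Qed.

(** The values of J and s used in [A_le_next], in terms of the integer u + 1
which is n^(1/14) rounded up: J is about 2 sqrt n, and s is at least 3 log_2 n + 2
because n <= 2^(14 (u + 1)). The last inequality has order u^11 on the left
against u^14 on the right, so it holds once u is large; u >= 499 suffices. *)
Lemma growth_parameters u n k :
    (499 <= u)%N -> (u ^ 14 < n <= u.+1 ^ 14)%N -> (k <= 14 * u.+1 ^ 3 + 2)%N ->
  [/\ (4 * n <= (2 * u.+1 ^ 7) ^ 2)%N,
      (2 * n ^ 2 * n.+1 <= 2 ^ (44 * u.+1))%N &
      ((4 * k + 2) * (44 * u.+1 * (2 * u.+1 ^ 7)) <= n)%N].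
Proof.
move=> u499 /andP[un nu] hk; split.
- by rewrite expnMn -expnM leq_pmul2l.
- have nt : (n <= 2 ^ (14 * u.+1))%N.
    by rewrite (leq_trans nu) // mulnC expnM leq_exp2r // ltnW // ltn_expl.
  have n0 : (0 < n)%N by lia.
  apply: (@leq_trans (4 * n ^ 3)).
    rewrite (_ : 4 * n ^ 3 = 2 * n ^ 2 * (2 * n))%N; last by rewrite mulnACA -expnSr.
    by rewrite leq_mul2l; apply/orP; right; lia.
  apply: (@leq_trans (2 ^ 2 * (2 ^ (14 * u.+1)) ^ 3)); first by rewrite leq_pmul2l // leq_exp2r.
  rewrite -expnM -expnD leq_exp2l //; lia.
apply: leq_trans (ltnW un).
have h1 : (4 * k + 2 <= 66 * u.+1 ^ 3)%N.
  have : (0 < u.+1 ^ 3)%N by rewrite expn_gt0.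
  by move: hk; set x := (_ ^ 3)%N; clearbody x; lia.
apply: (@leq_trans (66 * u.+1 ^ 3 * (44 * u.+1 * (2 * u.+1 ^ 7)))).
  by rewrite leq_mul2r h1 orbT.
rewrite (_ : _ * _ = 66 * 88 * u.+1 ^ 11)%N; last first.
  rewrite (_ : u.+1 ^ 11 = u.+1 ^ 3 * u.+1 * u.+1 ^ 7)%N; last by rewrite -expnSr -expnD.
  by set x := (_ ^ 3)%N; set y := (_ ^ 7)%N; clearbody x y; ring.
apply: (@leq_trans (66 * 88 * (2 * u) ^ 11)).
  by rewrite leq_mul2l leq_exp2r //; lia.
rewrite expnMn mulnA -[14%N]/(3 + 11)%N expnD leq_mul2r; apply/orP; right.
apply: (@leq_trans (499 ^ 3)); last by rewrite leq_exp2r.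
rewrite !expnS !expn0; lia.
Qed.

Theorem theorem1p3 (R : realType) :
  exists K : R, 0 < K /\
    forall C : R, 1 < C ->
      (forall k n : nat, (2 <= k)%N -> (0 < n)%N -> n%:R <= C ^+ k ->
        c n.-1 k * c n.+1 k <= c n k ^+ 2) ->
      forall n : nat, K * ((ln C) ^- 7 + 1) <= n%:R -> unimodalQ n.
Proof.
(* n >= 500^14 makes n^(1/14) >= 500, as required by [growth_parameters]. *)
exists (500%:R ^+ 14); split; first by rewrite exprn_gt0 ?ltr0n.
move=> C C1 hC n; set l := ln C; have l0 : 0 < l := ln_gt0 C1.
have K1 : 1 <= 500%:R ^+ 14 :> R by rewrite exprn_ege1 ?ler1n.
have K0 := le_trans ler01 K1; have l70 : 0 <= l ^- 7 by rewrite invr_ge0 exprn_ge0 // ltW.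
set K := _ ^+ 14 in K0 K1 * => nK.
have Kn : K <= n%:R by apply: le_trans nK; rewrite ler_peMr // lerDr.
have ln7 : l ^- 7 <= n%:R.
  apply: le_trans nK; apply: (@le_trans _ _ (l ^- 7 + 1)); first by rewrite lerDl.
  by rewrite ler_peMl // addr_ge0.
have n0 : (0 < n)%N by rewrite -(ltr0n R) (lt_le_trans ltr01) // (le_trans K1).
have ex_t : exists t, (n <= t ^ 14)%N by exists n; rewrite -[leqLHS]expn1 leq_pexp2l.
have [[|u] nt mint] := ex_minnP ex_t; first by move: nt; rewrite exp0n // leqNgt n0.
have un : (u ^ 14 < n)%N by rewrite ltnNge; apply/negP => /mint; rewrite ltnn.
have u499 : (499 <= u)%N.
  rewrite -ltnS -(@leq_exp2r _ _ 14) // -(ler_nat R) natrX.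
  by apply: le_trans Kn _; rewrite ler_nat.
set t := u.+1 in nt.
have t0 : 0 < t%:R :> R by rewrite ltr0n.
have lV : l^-1 <= t%:R ^+ 2.
  rewrite -(@ler_pXn2r _ 7) ?nnegrE ?exprn_ge0 ?invr_ge0 ?(ltW l0) ?(ltW t0) //.
  by rewrite exprVn -exprM -natrX (le_trans ln7) // ler_nat.
have ln_n : ln n%:R <= 14%:R * t%:R :> R.
  apply: (@le_trans _ _ (ln (t%:R ^+ 14))).
    by rewrite ler_ln ?posrE ?exprn_gt0 ?ltr0n // -natrX ler_nat.
  by rewrite lnXn // -[leLHS]mulr_natl ler_wpM2l // ltW // ln_sublinear.
have ln_n0 : 0 <= ln n%:R :> R by rewrite ln_ge0 // ler1n.
(* From k0 on, k ln C >= ln n. *)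
pose k0 := (Num.truncn (ln n%:R / l)).+2.
have k0_le : (k0 <= 14 * t ^ 3 + 2)%N.
  rewrite /k0 addn2 !ltnS -(ler_nat R) natrM natrX.
  have /andP[h _] := truncn_itv (divr_ge0 ln_n0 (ltW l0)); apply: le_trans h _.
  rewrite exprS mulrA; apply: ler_pM => //; by rewrite invr_ge0 ltW.
have nC k : (k0 <= k)%N -> n%:R <= C ^+ k.
  move=> kk; have C0 : 0 < C := lt_trans ltr01 C1.
  rewrite -ler_ln ?posrE ?exprn_gt0 ?ltr0n // lnXn // -[leRHS]mulr_natl -ler_pdivrMr //.
  rewrite (le_trans (ltW (truncnS_gt _))) // ler_nat; exact: ltnW.
have lc k : (k0 <= k)%N -> c_log_concave n k.
  move=> kk i /andP[i0 iln]; apply: hC => //; first exact: leq_trans kk.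
  by apply: le_trans (nC k kk); rewrite ler_nat.
have params k : (k <= k0)%N -> _ := fun kk =>
  @growth_parameters u n k u499 (introT andP (conj un nt)) (leq_trans kk k0_le).
apply: (@unimodal_of_log_concave n k0).
- have [_ _] := params k0 (leqnn _); apply: leq_trans.
  apply: (@leq_trans (4 * k0 + 2)).
    by rewrite (leq_trans (leq_pmull k0 (ltn0Sn 3))) // leq_addr.
  by rewrite leq_pmulr // !muln_gt0 expn_gt0.
- move=> k /ltnW /params[h1 h2 h3]; exact: A_le_next n0 h1 h2 h3.
exact: A_log_concave lc.
Qed.
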